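(* Let $\alpha>0$ be irrational, let $g:(0,1]\to\mathbb{R}$ be a bounded measurable function and let $h:\mathbb{R}\to\mathbb{R}$ be a continuous $\alpha$-periodic function. Let $f:\Sigma\to\mathbb{C}$ be $f(u,v)=g(u)h(v)$, and assume that $g$ is constant if $\int_0^\alpha h(v)\,dv\ne0$. Then there exists a constant $f^*\in\mathbb{C}$ such that for $\rho$-almost every $(u,v)\in\Sigma$ $$\lim_{n\to+\infty}\frac1n\sum_{k=0}^{n-1}f\circ F^k(u,v)=f^*.$$
   Context: $\Sigma=(0,1]\times[0,+\infty)$, and $\rho$ is the measure on $\Sigma$ given by $d\rho(u,v)=\frac{1}{1+uv}\,du\,dv$. The map $F$ is defined ($\rho$-almost everywhere) on $\Sigma$ by $$F(u,v)=\begin{cases}\left(v,\frac1v\left(\frac1u-1\right)\right) & \text{if } v<1,\\ (u,v-1) & \text{if } v\ge1.\end{cases}$$ It preserves $\rho$. *)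

(* Defs.v *)
From HB Require Import structures.
From mathcomp Require Import all_boot all_order all_algebra.
From mathcomp Require Import all_classical all_reals all_analysis.
From mathcomp Require Import measurable_realfun complex.
Set Implicit Arguments.
Unset Strict Implicit.
Unset Printing Implicit Defensive.
Import Order.TTheory GRing.Theory Num.Theory.
Import numFieldNormedType.Exports.
Local Open Scope classical_set_scope.
Local Open Scope ring_scope.

Definition Sigma (R : realType) : set (R * R) := `]0, 1] `*` `[0, +oo[.

Section rho.
Context (R : realType).
Local Notation plane := (measurableTypeR R * measurableTypeR R)%type.
Local Notation lebesgue2 := (@lebesgue_measure R \x @lebesgue_measure R)%E.

Definition rho_density (p : R * R) : R := (1 + p.1 * p.2)^-1.

(* [rho] is carried by [Sigma]: its complement in the plane is null. *)
Definition rho (A : set plane) : \bar R :=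
  (\int[lebesgue2]_(p in A `&` Sigma (R:=R)) (rho_density p)%:E)%E.

Let measurable_Sigma : measurable (Sigma (R:=R) : set plane).
Proof. by apply: measurableX; exact: measurable_itv. Qed.

Let rho_density_ge0 (p : R * R) : Sigma p -> 0 <= rho_density p.
Proof.
case: p => u v [/=]; rewrite !in_itv/= => /andP[u0 _]; rewrite andbT => v0.
by rewrite invr_ge0 addr_ge0// mulr_ge0// ltW.
Qed.

Let measurable_rho_density (A : set plane) :
  measurable A -> measurable_fun (A `&` Sigma (R:=R)) rho_density.
Proof.
move=> mA.
apply: (eq_measurable_fun (fun p : plane => (1 + p.1 * p.2) `^ (-1))).
  move=> [u v] /set_mem[_ [/=]].
  rewrite !in_itv/= => /andP[u0 _]; rewrite andbT => v0.
  by rewrite powR_inv1// addr_ge0// mulr_ge0// ltW.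
apply: measurable_funTS.
apply: (measurableT_comp (measurable_powR _)).
apply: measurable_funD => //.
by apply: measurable_funM; [exact: measurable_fst|exact: measurable_snd].
Qed.

Let rho0 : rho set0 = 0%E.
Proof. by rewrite /rho set0I integral_set0. Qed.

Let rho_ge0 A : (0 <= rho A)%E.
Proof.
by apply: integral_ge0 => p [_ pS]; rewrite lee_fin; exact: rho_density_ge0.
Qed.

Let rho_semi_sigma_additive : semi_sigma_additive rho.
Proof.
move=> B mB tB mUB; rewrite /rho setI_bigcupl ge0_integral_bigcup//=.
- apply: is_cvg_ereal_nneg_natsum_cond => n _ _; exact: rho_ge0.
- by move=> k; exact: measurableI.
- rewrite -setI_bigcupl; apply: measurableT_comp => //.
  exact: measurable_rho_density.
- by move=> p [k _ [_ pS]]; rewrite lee_fin; exact: rho_density_ge0.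
- exact: trivIset_setIr.
Qed.

HB.instance Definition _ := isMeasure.Build _ plane R rho
  rho0 rho_ge0 rho_semi_sigma_additive.

End rho.

(* The points with [v = 0], where [F] is undefined, form a [rho]-null set; they
   are sent to [(0, 0)], since [0^-1 = 0]. *)
Definition F (R : realType) (p : R * R) : R * R :=
  if p.2 < 1 then (p.2, p.2^-1 * (p.1^-1 - 1)) else (p.1, p.2 - 1).

(* Main.v *)
Require Import Defs.
From HB Require Import structures.
From mathcomp Require Import all_boot all_order all_algebra.
From mathcomp Require Import all_classical all_reals all_analysis.
From mathcomp Require Import measurable_realfun complex ring lra.
Import Order.TTheory GRing.Theory Num.Theory.
Import numFieldNormedType.Exports.
Local Open Scope classical_set_scope.
Local Open Scope ring_scope.

(* A window average of h over m consecutive integers is uniformly close to the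
   mean M of h, because alpha is irrational. Subtracting this average from h
   leaves psi(v) - psi(v + 1) with psi bounded. Along an orbit of F the second
   coordinate drops by one at each step, except at the visits to {v < 1}, so the
   sum of g(u) (psi(v) - psi(v + 1)) telescopes up to an error proportional to the
   number of visits. It remains to see that a.e. orbit visits {v < 1} with
   frequency zero. The set where this fails at a given rate is invariant, and has
   finite measure by the maximal ergodic inequality, since {v < 1} has; but an
   invariant set is 1-periodic in v, hence null or of infinite measure since
   1 / (1 + uv) is not integrable in v. *)

Set Implicit Arguments.
Unset Strict Implicit.
Unset Printing Implicit Defensive.

(** * Rotations and window averages *)

(** The measure [rho] is infinite and [f] need not be integrable, so a Birkhoff average cannot be
    read off as a space average of [f]. What replaces it is an estimate along a single orbit.
    Between two visits to [v < 1] the orbit descends vertically with [u] frozen, so the factor [g u]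
    does not disturb the telescoping there. What is left is the sum of [g u * M], and the hypothesis
    linking [g] to the integral of [h] says exactly that [g u * M] is a constant [kappa]: either
    [M = 0], or [g] is constant. This [kappa] is the limit. The maximal inequality needs [rho] to be
    invariant. A typical point has two preimages, one per branch, whose densities add up to
    [1 / (1 + u v)]. The first branch turns the old [v] into the new [u], so the computation is made
    fibre by fibre with Tonelli, at fixed [v] on the first branch and at fixed [u] on the second. *)

Section rotation.
Context (R : realType) (alpha : R).
Hypothesis alpha_gt0 : 0 < alpha.

Lemma mod_period (t : R) : exists z : int, 0 <= t - z%:~R * alpha < alpha.
Proof.
exists (Num.floor (t / alpha)).
have /andP[] := floor_itv (t / alpha).
rewrite ler_pdivlMr// ltr_pdivrMr// intrD mulrDl mul1r => h1 h2.
by rewrite subr_ge0 h1/= ltrBlDl.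
Qed.

Lemma bin_period (K : nat) (t : R) : (0 < K)%N -> 0 <= t < alpha ->
  exists2 k : nat, (k < K)%N & 0 <= t - k%:R * (alpha / K%:R) < alpha / K%:R.
Proof.
move=> K0 /andP[t0 ta]; have KR : (0 < K%:R :> R) by rewrite ltr0n.
have aK : 0 < alpha / K%:R by rewrite divr_gt0.
have tK : 0 <= t / (alpha / K%:R) by rewrite divr_ge0// ltW.
exists (Num.truncn (t / (alpha / K%:R))).
  by rewrite truncn_lt_nat// ltr_pdivrMr// mulrCA divff ?mulr1// gt_eqF.
have /andP[] := truncn_itv tK.
rewrite ler_pdivlMr// ltr_pdivrMr// -natr1 mulrDl mul1r => h1 h2.
by rewrite subr_ge0 h1/= ltrBlDl.
Qed.

Lemma period_lt (d : R) : 0 < d -> exists2 K : nat, (0 < K)%N & alpha / K%:R < d.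
Proof.
move=> d0; exists (Num.truncn (alpha / d)).+1 => //.
by rewrite ltr_pdivrMr// mulrC -ltr_pdivrMr//; exact: truncnS_gt.
Qed.

Hypothesis alphaN : irrational alpha.

Lemma rotation_neq0 (n : nat) (z : int) : (0 < n)%N ->
  n%:R - z%:~R * alpha != 0.
Proof.
move=> n0; apply/eqP => /eqP; rewrite subr_eq0 => /eqP nz.
have z0 : z%:~R != 0 :> R.
  by apply/eqP => z0; move: nz; rewrite z0 mul0r => /eqP; rewrite pnatr_eq0 gtn_eqF.
apply: alphaN; exists (n%:R / z%:~R) => //.
by rewrite fmorph_div/= ratr_nat ratr_int nz mulrAC divff ?mul1r.
Qed.

(** Pigeonhole: of the [K + 1] integers [0, ..., K] reduced modulo [alpha], two fall in the same one
    of [K] bins of length [alpha / K < d]; their difference works. *)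
Lemma rotation_small (d : R) : 0 < d ->
  exists (n : nat) (z : int), n%:R - z%:~R * alpha != 0 /\ `|n%:R - z%:~R * alpha| < d.
Proof.
move=> d0; have [K K0 Kd] := period_lt d0.
have [z zP] := choice (fun t : nat => mod_period t%:R).
have /choice[k kP] : forall i : 'I_K.+1, exists k : 'I_K,
    0 <= (i%:R - (z i)%:~R * alpha) - k%:R * (alpha / K%:R) < alpha / K%:R.
  by move=> i; have [k kK ?] := bin_period K0 (zP i); exists (Ordinal kK).
have /injectivePn[i [j ij kij]] : ~~ injectiveb k.
  by apply/injectiveP => /leq_card; rewrite !card_ord ltnn.
wlog ltij : i j ij kij / (i < j)%N.
  move=> H; have [|] := ltnP i j; first exact: H.
  rewrite leq_eqVlt => /orP[/eqP ji|]; first by rewrite (val_inj ji) eqxx in ij.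
  by apply: H => //; rewrite eq_sym.
exists (j - i)%N, (z j - z i); split; first by rewrite rotation_neq0// subn_gt0.
have := kP i; have := kP j; rewrite kij natrB 1?ltnW// intrB mulrBl.
set a := _ * _; set b := _%:~R * _; set c := _ * _ => H1 H2.
by apply: lt_trans Kd; rewrite ltr_norml; lra.
Qed.

(** The multiples of a nonzero [r] with [|r| < d] form a grid of mesh less than [d]. *)
Lemma rotation_dense (d t : R) : 0 < d ->
  exists (n : nat) (z : int), `|n%:R - z%:~R * alpha - t| < d.
Proof.
move=> d0; have [n [z [r0 rd]]] := rotation_small d0.
pose r : R := n%:R - z%:~R * alpha; rewrite -/r in r0 rd.
(* As [n] is a natural number, only nonnegative multiples of [r] may be used; moving [t] by [w]
   periods gives it the sign of [r]. *)
have [w tw] : exists w : int, 0 <= (t + w%:~R * alpha) / r.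
  have [m [mt1 mt2]] : exists m : nat, - (m%:R * alpha) < t /\ t < m%:R * alpha.
    exists (Num.truncn (`|t| / alpha)).+1; apply/andP.
    by rewrite -ltr_norml -ltr_pdivrMr//; exact: truncnS_gt.
  have tp : 0 <= t + m%:R * alpha by lra.
  have tn : 0 <= - (t - m%:R * alpha) by lra.
  have [rp|rn] := ltP 0 r; first by exists m%:Z; rewrite divr_ge0// ltW.
  exists (- m%:Z); rewrite rmorphN/= mulNr -(opprK r) invrN mulrN -mulNr.
  by rewrite mulr_ge0// invr_ge0 oppr_ge0.
pose k := Num.truncn ((t + w%:~R * alpha) / r).
exists (k * n)%N, (k%:Z * z + w).
have -> : (k * n)%:R - (k%:Z * z + w)%:~R * alpha - t =
    - (((t + w%:~R * alpha) / r - k%:R) * r).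
  rewrite natrM intrD intrM mulrBl divfK// /r; ring.
rewrite normrN normrM (le_lt_trans _ rd)// ler_piMl//.
have /andP[] := truncn_itv tw; rewrite -/k -natr1 => h1 h2.
by rewrite ler_norml; apply/andP; split; lra.
Qed.

(** Modulo [alpha], every [t] is within [d / 2] of one of finitely many bin endpoints, so the
    largest [n] needed for these endpoints bounds all the others. *)
Lemma rotation_uniformly_dense (d : R) : 0 < d -> exists N : nat, forall t,
  exists (n : nat) (z : int), (n <= N)%N /\ `|n%:R - z%:~R * alpha - t| < d.
Proof.
move=> d0; have d20 : 0 < d / 2 by rewrite divr_gt0.
have [K K0 Kd] := period_lt d20.
have [n nP] := choice (fun k : nat => rotation_dense (k%:R * (alpha / K%:R)) d20).
exists (\max_(k < K) n k)%N => t.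
have [w wP] := mod_period t; have [k kK kP] := bin_period K0 wP.
have [z zP] := nP k; exists (n k), (z - w); split.
  exact: (leq_bigmax (Ordinal kK)).
rewrite intrB mulrBl [d in _ < d](splitr d).
rewrite (_ : _ - _ - t = ((n k)%:R - (z%:~R * alpha) - k%:R * (alpha / K%:R))
  - (t - w%:~R * alpha - k%:R * (alpha / K%:R))); last by ring.
rewrite (le_lt_trans (ler_normB _ _))// ltrD// ger0_norm; first by
  case/andP: kP => _ /lt_trans; exact.
by case/andP: kP.
Qed.

End rotation.

(** * Bounds and uniform continuity of continuous periodic functions *)

Section periodic.
Context (R : realType) (alpha : R) (h : R -> R).
Hypotheses (alpha_gt0 : 0 < alpha) (ch : continuous h) (ph : periodic h alpha).

Lemma periodicz (x : R) (z : int) : h (x + z%:~R * alpha) = h x.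
Proof.
have pn y n : h (y + n%:R * alpha) = h y by rewrite mulr_natl periodicn.
case: z => n; first exact: pn.
by rewrite NegzE rmorphN/= mulNr -[in RHS](subrK (n.+1%:R * alpha) x) pn.
Qed.

Lemma continuous_periodic_bounded : exists2 C, 0 <= C & forall x, `|h x| <= C.
Proof.
have /compact_bounded[M [_ MP]] : compact (h @` `[0, alpha]).
  apply: continuous_compact; last exact: segment_compact.
  exact: continuous_subspaceT.
exists (`|M| + 1) => [|x]; first by rewrite addr_ge0.
have [z /andP[z0 za]] := mod_period alpha_gt0 x.
have Mlt : M < `|M| + 1 by rewrite (le_lt_trans (ler_norm M))// ltrDl.
apply: (MP _ Mlt); exists (x - z%:~R * alpha) => /=.
  by rewrite in_itv/= z0 ltW.
by rewrite -mulNr -rmorphN periodicz.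
Qed.

(** Compactness of one period gives a [d] valid for [x] in [[0, alpha]] and arbitrary real [y].
    Translating [x] and [y] by the same multiple of [alpha] then covers all pairs, including those
    that straddle the end of a period. *)
Lemma continuous_periodic_unif (e : R) : 0 < e ->
  exists2 d, 0 < d & forall x y, `|x - y| < d -> `|h x - h y| <= e.
Proof.
move=> e0; have cpt : compact `[0, alpha] := @segment_compact _ _ _.
move/compact_near_coveringP : cpt => /(_ R 0^'+
  (fun d x => forall y, `|x - y| < d -> `|h x - h y| <= e)).
have e20 : 0 < e / 2 by rewrite divr_gt0.
case.
- move=> x _.
  have /cvgrPdist_lt/(_ _ e20)[r /= r0 rP] : h z @[z --> (x : R)] --> h x by exact: ch.
  near=> x' d.
  have xx' : `|x - x'| < r / 2.
    by near: x'; exists (r / 2) => /=; [rewrite divr_gt0| move=> ?].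
  have dr : d < r / 2 by near: d; apply: nbhs_right_lt; rewrite divr_gt0.
  move=> y xy; rewrite -(subrKA (h x)) [leRHS](splitr e) (le_trans (ler_normD _ _))//.
  rewrite lerD// ltW//; last first.
    apply: rP => /=; rewrite -(subrKA x') (le_lt_trans (ler_normD _ _))//.
    by rewrite [ltRHS](splitr r) ltrD// (lt_trans xy).
  rewrite distrC; apply: rP => /=; rewrite (lt_le_trans xx')//.
  by rewrite ler_pdivrMr// ler_pMr// ler1n.
- move=> d /= d0 dP; exists (d / 2); first by rewrite divr_gt0.
  move=> x y xy; have [z /andP[z0 za]] := mod_period alpha_gt0 x.
  rewrite -[h x](periodicz _ (- z)) -[h y](periodicz _ (- z)).
  apply: (dP (d / 2)) => //=.
  + by rewrite sub0r normrN gtr0_norm ?divr_gt0// ltr_pdivrMr// ltr_pMr// ltr1n.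
  + by rewrite divr_gt0.
  + by rewrite in_itv/= rmorphN/= mulNr z0 ltW.
  + by rewrite [X in `|X|](_ : _ = x - y)//; ring.
Unshelve. all: by end_near. Qed.

End periodic.

Section shift.
Context (R : realType).
Local Notation mu := (@lebesgue_measure R).

Lemma measurable_shift (c : R) :
  measurable_fun setT (fun x : R => x + c : measurableTypeR R).
Proof. exact: measurable_funD. Qed.

(** By uniqueness of Lebesgue measure, it suffices to compare lengths of the intervals []a, b]]. *)
Lemma lebesgue_measure_shift (c : R) (A : set R) : measurable A ->
  pushforward mu (fun x : R => x + c : measurableTypeR R) A = mu A.
Proof.
have ms := measurable_shift c.
move=> mA; apply/esym/(@lebesgue_measure_unique _
  (pushforward mu (fun x : R => x + c : measurableTypeR R))) => //= _ [[a b]] _ <-.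
rewrite /pushforward (_ : _ @^-1` _ = `]a - c, b - c]%classic).
  by rewrite !lebesgue_measure_itv/= !lte_fin ltrD2r -!EFinB opprB addrA subrK.
by apply/seteqP; split => x /=; rewrite !in_itv/= ltrBlDr lerBrDr.
Qed.

Lemma ge0_integral_shift (c : R) (D : set R) (f : R -> \bar R) :
  measurable D -> measurable_fun D f -> (forall x, D x -> 0 <= f x)%E ->
  (\int[mu]_(x in D) f x = \int[mu]_(x in (+%R^~ c) @^-1` D) f (x + c)%R)%E.
Proof.
move=> mD mf f0.
have := @ge0_integral_pushforward _ _ (measurableTypeR R) (measurableTypeR R) R
  _ (measurable_shift c) mu D f.
move=> /= <-//.
- apply: eq_measure_integral => [|ms A mA AD]; first exact: measurable_shift.
  exact/esym/lebesgue_measure_shift.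
- by move=> x /set_mem; exact: f0.
Qed.

Lemma Rintegral_shift (c : R) (D : set R) (f : R -> R) :
  measurable D -> measurable_fun setT f ->
  mu.-integrable ((+%R^~ c) @^-1` D) (EFin \o (fun x => f (x + c))) ->
  \int[mu]_(x in D) f x = \int[mu]_(x in (+%R^~ c) @^-1` D) f (x + c).
Proof.
move=> mD mf fi; congr fine.
have := @integral_pushforward _ _ (measurableTypeR R) (measurableTypeR R) R
  _ (measurable_shift c) mu D (EFin \o f).
move=> /= <-//.
- apply: eq_measure_integral => [|ms A mA AD]; first exact: measurable_shift.
  exact/esym/lebesgue_measure_shift.
- exact/measurable_EFinP.
Qed.

End shift.

Section periodic_integral.
Context (R : realType) (alpha : R) (h : R -> R).
Hypotheses (alpha_gt0 : 0 < alpha) (ch : continuous h) (ph : periodic h alpha).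
Local Notation mu := (@lebesgue_measure R).

Lemma continuous_itv_integrable (k : R -> R) (b0 b1 : bool) (a b : R) : continuous k ->
  mu.-integrable [set` Interval (BSide b0 a) (BSide b1 b)] (EFin \o k).
Proof.
move=> ck; have : mu.-integrable `[a, b] (EFin \o k).
  apply: continuous_compact_integrable; first exact: segment_compact.
  exact: continuous_subspaceT.
apply: integrableS => //.
by move=> x; case: b0 b1 => -[] /=; rewrite !in_itv/= => /andP[? ?];
  apply/andP; split => //; exact: ltW.
Qed.

Lemma continuous_shiftr (c : R) : continuous (fun x => h (x + c)).
Proof.
move=> x; apply: (@continuous_comp _ _ _ (+%R^~ c) h); last exact: ch.
by apply: continuousD => //; exact: cvg_cst.
Qed.

(** Reduce the shift to [r] in [[0, alpha)], cut [[r, alpha + r]] at [alpha], and bring the piece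
    beyond [alpha] back to [[0, r]] by periodicity. *)
Lemma Rintegral_periodic_shift (c : R) :
  \int[mu]_(x in `[0, alpha]) h (x + c) = \int[mu]_(x in `[0, alpha]) h x.
Proof.
have mh : measurable_fun setT h by exact: continuous_measurable_fun.
have [z /andP[z0 za]] := mod_period alpha_gt0 c.
set r := c - _ in z0 za.
have -> : (fun x => h (x + c)) = (fun x => h (x + r)).
  apply/funext => x; rewrite -[RHS](periodicz ph _ z); congr h.
  by rewrite /r addrA subrK.
have hi (b0 b1 : bool) (a b : R) :
  mu.-integrable [set` Interval (BSide b0 a) (BSide b1 b)] (EFin \o h).
  exact: continuous_itv_integrable.
have sh (d a b : R) : \int[mu]_(x in `[a + d, b + d]) h x = \int[mu]_(x in `[a, b]) h (x + d).
  have E : (+%R^~ d) @^-1` `[a + d, b + d] = `[a, b]%classic.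
    by apply/seteqP; split => x /=; rewrite !in_itv/= !lerD2r.
  rewrite (@Rintegral_shift _ d)// E//.
  by apply: continuous_itv_integrable; exact: continuous_shiftr.
rewrite -sh add0r.
have split (a b m : R) : a <= m -> m <= b -> \int[mu]_(x in `[a, b]) h x =
   \int[mu]_(x in `[a, m]) h x + \int[mu]_(x in `[m, b]) h x.
  move=> am mb; apply/eqP; rewrite addrC -subr_eq (Rintegral_itvB (hi _ _ _ _))//.
    by rewrite Rintegral_itv_obnd_cbnd.
rewrite (split _ _ alpha); last 2 first.
- exact: ltW.
- by rewrite lerDl.
rewrite [RHS](split _ _ r)//; last exact: ltW.
rewrite addrC; congr +%R.
rewrite (addrC alpha) -[X in `[X, _]](add0r alpha) sh; apply: eq_Rintegral => x _.
by rewrite ph.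
Qed.

End periodic_integral.

Section equidistribution.
Context (R : realType) (alpha : R) (h : R -> R).
Hypotheses (alpha_gt0 : 0 < alpha) (ch : continuous h) (ph : periodic h alpha).
Local Notation mu := (@lebesgue_measure R).

Lemma continuous_shift_sum (m : nat) :
  continuous (fun x : R => \sum_(i < m) h (x + i%:R)).
Proof.
elim: m => [|m IH].
  rewrite (_ : (fun x => _) = cst 0); first exact: cst_continuous.
  by apply/funext => x; rewrite big_ord0.
rewrite (_ : (fun x => _) =
  (fun x : R => \sum_(i < m) h (x + i%:R)) \+ (fun x : R => h (x + m%:R))).
  by move=> x; apply: continuousD; [exact: IH|exact: continuous_shiftr].
by apply/funext => x; rewrite big_ord_recr.
Qed.

Lemma Rintegral_shift_sum (m : nat) :
  \int[mu]_(x in `[0, alpha]) (\sum_(i < m) h (x + i%:R)) =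
  m%:R * \int[mu]_(x in `[0, alpha]) h x.
Proof.
elim: m => [|m IH].
  rewrite mul0r (_ : (fun x => _) = cst 0) ?Rintegral_cst ?mul0r//.
  by apply/funext => x; rewrite big_ord0.
rewrite -natr1 mulrDl -IH mul1r -(Rintegral_periodic_shift alpha_gt0 ch ph m%:R).
rewrite -RintegralD//.
- by congr Rintegral; apply/funext => x; rewrite big_ord_recr.
- by apply: continuous_itv_integrable; exact: continuous_shift_sum.
- by apply: continuous_itv_integrable; exact: continuous_shiftr.
Qed.

(** Moving the window by one unit adds one term and drops one, at a cost of at most [2 * C],
    whatever its length [m]. *)
Lemma shift_sum_osc (C x : R) (m n : nat) : (forall x, `|h x| <= C) ->
  `|\sum_(i < m) h (x + n%:R + i%:R) - \sum_(i < m) h (x + i%:R)| <= 2 * C * n%:R.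
Proof.
move=> hC; have C0 : 0 <= C by exact: le_trans (hC 0).
elim: n => [|n IH]; first by rewrite addr0 subrr normr0 mulr0.
rewrite -(subrKA (\sum_(i < m) h (x + n%:R + i%:R))) (le_trans (ler_normD _ _))//.
rewrite -natr1 mulrDr mulr1 addrC; apply: lerD => //.
have -> : \sum_(i < m) h (x + (n%:R + 1) + i%:R) - \sum_(i < m) h (x + n%:R + i%:R) =
    h (x + n%:R + m%:R) - h (x + n%:R).
  rewrite -sumrB -[RHS]/(h (x + n%:R + m%:R) - h (x + n%:R)).
  have /(telescope_sumr (fun i => h (x + n%:R + i%:R))) := leq0n m.
  rewrite addr0 => <-; rewrite big_mkord; apply: eq_bigr => i _.
  by rewrite -natr1; congr (h _ - _); ring.
rewrite (le_trans (ler_normB _ _))//; have := hC (x + n%:R + m%:R); have := hC (x + n%:R).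
set a := `|_|; set b := `|_|; lra.
Qed.

Hypothesis alphaN : irrational alpha.

(* Irrationality of [alpha] makes the nonnegative integers dense modulo [alpha],
   and a long window average hardly changes when the window moves by a bounded
   integer: hence it is nearly constant, equal to its own mean. *)
Lemma equidistribution (e : R) : 0 < e -> exists2 m : nat, (0 < m)%N & forall x,
  `|m%:R^-1 * \sum_(i < m) h (x + i%:R) -
    alpha^-1 * \int[mu]_(v in `[0, alpha]) h v| <= e.
Proof.
move=> e0; have e20 : 0 < e / 2 by rewrite divr_gt0.
have [C C0 hC] := continuous_periodic_bounded alpha_gt0 ch ph.
have [d d0 hd] := continuous_periodic_unif alpha_gt0 ch ph e20.
have [N NP] := rotation_uniformly_dense alpha_gt0 alphaN d0.
(* [N] is fixed before [m]: once the window is long enough, sliding it by up to [N] units costs at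
   most [e / 2] per term. The other [e / 2] pays for the distance [d] in uniform continuity. *)
have [m mn0 mP] : exists2 m : nat, (0 < m)%N & 2 * C * N%:R <= m%:R * (e / 2).
  exists (Num.truncn (2 * C * N%:R / (e / 2))).+1 => //.
  by rewrite -ler_pdivrMr// ltW//; exact: truncnS_gt.
have m0 : 0 < m%:R :> R by rewrite ltr0n.
exists m => // x.
pose S x := \sum_(i < m) h (x + i%:R).
have osc y : `|S y - S x| <= m%:R * e.
  have [n [z [nN nz]]] := NP (y - x).
  rewrite -(subrKA (S (x + n%:R))) (le_trans (ler_normD _ _))//.
  have -> : m%:R * e = m%:R * (e / 2) + m%:R * (e / 2) by rewrite -mulrDr -splitr.
  apply: lerD; last first.
    rewrite (le_trans (shift_sum_osc _ _ _ hC))// (le_trans _ mP)//.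
    by rewrite ler_wpM2l ?mulr_ge0// ler_nat.
  rewrite -sumrB (le_trans (ler_norm_sum _ _ _))//.
  rewrite (_ : m%:R * (e / 2) = \sum_(i < m) e / 2); last first.
    by rewrite sumr_const card_ord mulr_natl.
  apply: ler_sum => i _.
  rewrite -[h (x + _ + _)](periodicz ph _ (- z)) hd//.
  rewrite -normrN (_ : - _ = n%:R - z%:~R * alpha - (y - x))//.
  by rewrite rmorphN/=; ring.
have cS : continuous S by exact: continuous_shift_sum.
have iS : mu.-integrable `[0, alpha] (EFin \o S).
  exact: continuous_itv_integrable.
have ic (c : R) : mu.-integrable `[0, alpha] (EFin \o (fun=> c)).
  by apply: continuous_itv_integrable; exact: cst_continuous.
have iE := Rintegral_shift_sum m; rewrite -/S in iE.
have muE (c : R) : \int[mu]_(x in `[0, alpha]) c = c * alpha.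
  by rewrite Rintegral_cst//= lebesgue_measure_itv/= lte_fin alpha_gt0 -EFinB subr0.
(* Integrate the bounds [S x - m e <= S y <= S x + m e] over [y] in one period; the integral of [S]
   is [m] times that of [h]. *)
have lo : (S x - m%:R * e) * alpha <= m%:R * \int[mu]_(v in `[0, alpha]) h v.
  rewrite -iE -muE le_Rintegral// => y _.
  by have := osc y; rewrite ler_norml => /andP[+ _]; rewrite lerBrDr addrC.
have hi : m%:R * \int[mu]_(v in `[0, alpha]) h v <= (S x + m%:R * e) * alpha.
  rewrite -iE -muE le_Rintegral// => y _.
  by have := osc y; rewrite ler_norml => /andP[_]; rewrite lerBlDr addrC.
set I := \int[_]_(_ in _) _ in lo hi *; rewrite -/(S x).
rewrite -(ler_pM2l m0) -(ler_pM2l alpha_gt0) -{1}(gtr0_norm m0) -{1}(gtr0_norm alpha_gt0).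
rewrite -!normrM (_ : _ * _ = alpha * S x - m%:R * I); last first.
  by field; rewrite !gt_eqF.
by rewrite ler_norml; apply/andP; split; lra.
Qed.

End equidistribution.

(** * Invariance of rho *)

Lemma measurable_inv (R : realType) : measurable_fun setT (@GRing.inv R).
Proof.
rewrite -(setvU [set 0]); apply/measurable_funU => //.
  by apply: measurableC.
split; last exact: measurable_fun_set1.
apply: open_continuous_measurable_fun.
  exact/closed_openC/closed_eq.
by move=> x /set_mem/eqP/inv_continuous.
Qed.

Section tonelli_rectangle.
Local Open Scope ereal_scope.
Context d1 d2 (T1 : measurableType d1) (T2 : measurableType d2) (R : realType).
Variables (m1 : {sigma_finite_measure set T1 -> \bar R})
  (m2 : {sigma_finite_measure set T2 -> \bar R}).
Variables (A : set T1) (B : set T2) (f : T1 * T2 -> \bar R).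
Hypotheses (mA : measurable A) (mB : measurable B).
Hypothesis mf : measurable_fun (A `*` B) f.
Hypothesis f0 : forall p, (A `*` B) p -> 0 <= f p.

(** Tonelli's theorem is applied to the extension by zero, since measurability and positivity of [f]
    are known on the rectangle only. *)
Let g := f \_ (A `*` B).

Let mg : measurable_fun setT g.
Proof. exact/(measurable_restrictT _ (measurableX mA mB)). Qed.

Let g0 p : 0 <= g p.
Proof. by rewrite /g patchE; case: ifPn => // /set_mem; exact: f0. Qed.

Let gF x : \int[m2]_y g (x, y) = ((fun x => \int[m2]_(y in B) f (x, y)) \_ A) x.
Proof.
rewrite patchE; case: ifPn => [xA|xA].
  rewrite [RHS]integral_mkcond; apply: eq_integral => y _; rewrite /g !patchE.
  by rewrite in_setX xA.
by rewrite integral0_eq// => y _; rewrite /g patchE in_setX (negbTE xA).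
Qed.

Let gG y : \int[m1]_x g (x, y) = ((fun y => \int[m1]_(x in A) f (x, y)) \_ B) y.
Proof.
rewrite patchE; case: ifPn => [yB|yB].
  rewrite [RHS]integral_mkcond; apply: eq_integral => x _; rewrite /g !patchE.
  by rewrite in_setX yB andbT.
by rewrite integral0_eq// => x _; rewrite /g patchE in_setX (negbTE yB) andbF.
Qed.

Lemma tonelli_rectangle1 :
  \int[m1 \x m2]_(p in A `*` B) f p = \int[m1]_(x in A) \int[m2]_(y in B) f (x, y).
Proof.
rewrite integral_mkcond [RHS]integral_mkcond -/g (fubini_tonelli1 g)//.
by apply: eq_integral => x _; exact: gF.
Qed.

Lemma tonelli_rectangle2 :
  \int[m1 \x m2]_(p in A `*` B) f p = \int[m2]_(y in B) \int[m1]_(x in A) f (x, y).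
Proof.
rewrite integral_mkcond [RHS]integral_mkcond -/g (fubini_tonelli2 g)//.
by apply: eq_integral => y _; exact: gG.
Qed.

Lemma measurable_tonelli_rectangle1 :
  measurable_fun A (fun x => \int[m2]_(y in B) f (x, y)).
Proof.
apply/(measurable_restrictT _ mA).
have /funext <- := gF; exact: measurable_fun_fubini_tonelli_F.
Qed.

Lemma measurable_tonelli_rectangle2 :
  measurable_fun B (fun y => \int[m1]_(x in A) f (x, y)).
Proof.
apply/(measurable_restrictT _ mB).
have /funext <- := gG; exact: measurable_fun_fubini_tonelli_G.
Qed.

End tonelli_rectangle.

Section density_measure.
Local Open Scope ereal_scope.
Context d (T : measurableType d) (R : realType) (mu : {measure set T -> \bar R}).

(** The proofs [mf] and [f0] are arguments so that a measure structure can be attached to the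
    resulting set function. *)
Definition density_measure (f : T -> \bar R) (mf : measurable_fun setT f)
  (f0 : forall x, 0 <= f x) (A : set T) : \bar R := \int[mu]_(t in A) f t.

Variables (f : T -> \bar R) (mf : measurable_fun setT f) (f0 : forall x, 0 <= f x).

Let density0 : density_measure mf f0 set0 = 0.
Proof. exact: integral_set0. Qed.

Let density_ge0 A : 0 <= density_measure mf f0 A.
Proof. exact: integral_ge0. Qed.

HB.instance Definition _ := isMeasure.Build _ _ _ (density_measure mf f0)
  density0 density_ge0 (semi_sigma_additive_nng_induced mf f0).

End density_measure.

Lemma FTC2_is_derive (R : realType) (f F : R -> R) (a b : R) : a < b ->
  (forall x, a <= x <= b -> {for x, continuous f}) ->
  (forall x, a <= x <= b -> is_derive x 1 F (f x)) ->
  (\int[@lebesgue_measure R]_(x in `[a, b]) (f x)%:E = (F b)%:E - (F a)%:E)%E.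
Proof.
move=> ab cf dF; have cF x : a <= x <= b -> {for x, continuous F}.
  by move=> /dF ?; apply/differentiable_continuous/derivable1_diffP.
apply: continuous_FTC2 => //.
- apply: continuous_in_subspaceT => x /set_mem/=; rewrite in_itv/=; exact: cf.
- split.
  + by move=> x; rewrite in_itv/= => /andP[/ltW ax /ltW xb]; case: (dF x); rewrite ?ax.
  + by apply: cvg_at_right_filter; apply: cF; rewrite lexx ltW.
  + by apply: cvg_at_left_filter; apply: cF; rewrite lexx ltW.
- move=> x; rewrite in_itv/= => /andP[/ltW ax /ltW xb].
  by rewrite derive1E; case: (dF x); rewrite ?ax.
Qed.

(** * Change of variables on a fibre of the first branch *)

Section fibre.
Context (R : realType) (a : R).
Hypothesis a0 : 0 < a.
Local Notation mu := (@lebesgue_measure R).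

Definition first_branch (u : R) : R := a^-1 * (u^-1 - 1).
(** Substituting [u = 1 / (1 + a s)], with [|du/ds| = a / (1 + a s)^2], in [du / (1 + u a)] gives
    this density in [s]. *)
Definition first_branch_density (s : R) : R := a / ((1 + a * s) * (1 + a * s + a)).

Lemma measurable_first_branch :
  measurable_fun setT (first_branch : measurableTypeR R -> measurableTypeR R).
Proof.
apply: measurable_funM => //; apply: measurable_funD => //; exact: measurable_inv.
Qed.

Lemma first_branch_density_ge0 s : 0 <= s -> 0 <= first_branch_density s.
Proof. by move=> s0; rewrite divr_ge0 ?mulr_ge0 ?addr_ge0 ?mulr_ge0// ltW. Qed.

Let d (u : R) := (1 + u * a)^-1.

Let md : measurable_fun setT d.
Proof.
apply: (measurableT_comp (@measurable_inv R)); apply: measurable_funD => //.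
exact: measurable_funM.
Qed.

Lemma measurable_first_branch_density : measurable_fun setT first_branch_density.
Proof.
apply: measurable_funM => //; apply: (measurableT_comp (@measurable_inv R)).
by apply: measurable_funM; repeat apply: measurable_funD => //; apply: measurable_funM.
Qed.

Local Notation D1 := (`]0%R, 1%R]%classic : set R).
Local Notation D2 := (`[0%R, +oo[%classic : set R).

Let f1 := (EFin \o d) \_ D1.
Let f2 := (EFin \o first_branch_density) \_ D2.

Let mf1 : measurable_fun setT f1.
Proof.
apply/(measurable_restrictT _ (measurable_itv _)).
exact/measurable_funTS/measurable_EFinP.
Qed.

Let mf2 : measurable_fun setT f2.
Proof.
apply/(measurable_restrictT _ (measurable_itv _)).
apply/measurable_funTS/measurable_EFinP; exact: measurable_first_branch_density.
Qed.

Let f10 u : (0 <= f1 u)%E.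
Proof.
rewrite /f1 patchE; case: ifPn => // /set_mem/=; rewrite in_itv/= => /andP[u0 _].
by rewrite lee_fin invr_ge0 addr_ge0// mulr_ge0// ltW.
Qed.

Let f20 s : (0 <= f2 s)%E.
Proof.
rewrite /f2 patchE; case: ifPn => // /set_mem/=; rewrite in_itv/= andbT => s0.
by rewrite lee_fin first_branch_density_ge0.
Qed.

Let m1 := pushforward (density_measure mu mf1 f10)
  (first_branch : measurableTypeR R -> measurableTypeR R).
Let m2 := density_measure mu mf2 f20.

Let m1E W : m1 W = (\int[mu]_(u in D1) (\1_W (first_branch u) * d u)%:E)%E.
Proof.
rewrite /m1 /pushforward /density_measure -integral_mkcondr integral_mkcondl.
apply: eq_integral => u _; rewrite patchE indicE /preimage/=.
by case: ifPn => [/set_mem/= /mem_set -> |/negP uW]; rewrite ?mul1r//;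
  case: (boolP (_ \in W)) => [/set_mem uW'|_]; rewrite ?mul0r//; case: uW; apply/mem_set.
Qed.

Let m2E W : m2 W = (\int[mu]_(s in D2) (\1_W s * first_branch_density s)%:E)%E.
Proof.
rewrite /m2 /density_measure -integral_mkcondr integral_mkcondl.
apply: eq_integral => u _; rewrite patchE indicE.
by case: (u \in W); rewrite ?mul1r ?mul0r.
Qed.

Let aff_gt0 (p x : R) : 0 < p -> 0 <= x -> 0 < p + a * x.
Proof. by move=> p0 x0; rewrite ltr_wpDr// mulr_ge0// ltW. Qed.

Let is_derive_ln_aff (p x : R) : 0 < p -> 0 <= x ->
  is_derive x 1 (fun x => ln (p + a * x)) (a / (p + a * x)).
Proof.
move=> p0 x0; have px := aff_gt0 p0 x0.
have dl : is_derive (p + a * x) 1 (@ln R) (p + a * x)^-1 by exact: is_derive1_ln.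
have da : is_derive x 1 (fun x => p + a * x) a.
  by apply: is_derive_eq; rewrite add0r mul1r -[_%:A]/(a * 1) mulr1.
by rewrite mulrC; exact: (is_derive1_comp (f := @ln R)).
Qed.

Let continuous_inv_aff (p x : R) : 0 < p -> 0 <= x ->
  {for x, continuous (fun x => (p + a * x)^-1)}.
Proof.
move=> p0 x0; apply: cvgV; first by rewrite gt_eqF// aff_gt0.
by apply: cvgD; [exact: cvg_cst|apply: cvgM; [exact: cvg_cst|exact: cvg_id]].
Qed.

(** Both masses are explicit logarithms. The first branch is decreasing and takes the value [y] at
    [c]; the second density splits as [1 / (1 + a s) - 1 / (1 + a + a s)]. The values agree because
    [1 + a c = (1 + a + a y) / (1 + a y)]. *)
Let ray (y : R) : 0 < y -> exists x : R,
  m1 `]-oo, y[%classic = x%:E /\ m2 `]-oo, y[%classic = x%:E.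
Proof.
move=> y0; pose c := (1 + a * y)^-1.
have py : 0 < 1 + a * y by exact: aff_gt0 (ltW _).
have c0 : 0 < c by rewrite invr_gt0.
have c1 : c < 1 by rewrite invf_lt1// ltrDl mulr_gt0.
exists (a^-1 * ln (1 + a * 1) - a^-1 * ln (1 + a * c)); split.
transitivity (\int[mu]_(u in `]c, 1%R]) (d u)%:E)%E.
  have fb u : 0 < u -> (first_branch u < y) = (c < u).
    move=> u0; rewrite /first_branch mulrC ltr_pdivrMr// ltrBlDl [y * a]mulrC.
    by rewrite invf_plt// posrE.
  rewrite /m1 /pushforward /density_measure -integral_mkcondr; congr integral.
  apply/seteqP; split=> u /=; rewrite !in_itv/=.
    by move=> [+ /andP[u0 ->]]; rewrite andbT fb.
  by move=> /andP[cu u1]; have u0 := lt_trans c0 cu; rewrite u0 u1 fb.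
rewrite integral_itv_obnd_cbnd; last exact/measurable_funTS/measurable_EFinP.
transitivity ((a^-1 * ln (1 + a * 1))%:E - (a^-1 * ln (1 + a * c))%:E)%E; last first.
  by rewrite EFinB.
  apply: (@FTC2_is_derive _ d (fun u => a^-1 * ln (1 + a * u))) => // x /andP[cx _].
    have x0 : 0 <= x by rewrite (le_trans _ cx) ?ltW.
    rewrite (_ : d = fun u => (1 + a * u)^-1); first exact: continuous_inv_aff.
    by apply/funext => u; rewrite /d mulrC.
  have x0 : 0 <= x by rewrite (le_trans _ cx) ?ltW.
  have -> : d x = a^-1 * (a / (1 + a * x)).
    by rewrite mulKf ?gt_eqF// /d (mulrC a).
  by have := is_derive_ln_aff ltr01 x0 => ?; exact: is_deriveZ.
transitivity (\int[mu]_(s in `[0%R, y[) (first_branch_density s)%:E)%E.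
  rewrite /m2 /density_measure -integral_mkcondr; congr integral.
  apply/seteqP; split=> s /=; rewrite !in_itv/= ?andbT; first by move=> [-> ->].
  by move=> /andP[-> ->].
rewrite integral_itv_bndo_bndc; last by
  apply/measurable_funTS/measurable_EFinP; exact: measurable_first_branch_density.
have -> : (\int[mu]_(s in `[0%R, y]) (first_branch_density s)%:E =
    (a^-1 * (ln (1 + a * y) - ln (1 + a + a * y)))%:E -
    (a^-1 * (ln (1 + a * 0) - ln (1 + a + a * 0)))%:E)%E.
  have a10 : 0 < 1 + a by rewrite addr_gt0.
  apply: (@FTC2_is_derive _ first_branch_density
    (fun s => a^-1 * (ln (1 + a * s) - ln (1 + a + a * s)))) => // x /andP[x0 _].
    rewrite (_ : first_branch_density = fun s => a * ((1 + a * s)^-1 * (1 + a + a * s)^-1)).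
      apply: cvgM; first exact: cvg_cst.
      by apply: cvgM; exact: continuous_inv_aff.
    by apply/funext => s; rewrite /first_branch_density -invfM (addrAC 1 (a * s)).
  have -> : first_branch_density x = a^-1 * (a / (1 + a * x) - a / (1 + a + a * x)).
    rewrite /first_branch_density; field.
    by rewrite !gt_eqF ?aff_gt0// ?(addrAC 1 (a * x)) ?aff_gt0.
  have := is_derive_ln_aff ltr01 x0; have := is_derive_ln_aff a10 x0 => ? ?.
  exact: is_deriveZ.
rewrite -!EFinB; congr EFin; rewrite mulr0 !addr0 mulr1 ln1 -!mulrBr; congr (_ * _).
have -> : 1 + a * c = (1 + a + a * y) / (1 + a * y).
  by rewrite /c; field; rewrite gt_eqF.
rewrite ln_div ?posrE//; last by rewrite aff_gt0 ?addr_gt0// ltW.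
ring.
Qed.

(** The two sides are measures in [W]. Open rays are stable under intersection and generate the
    measurable sets, so agreement on rays suffices. *)
Lemma first_branch_fibre (W : set R) : measurable W ->
  (\int[mu]_(u in `]0%R, 1%R]) (\1_W (first_branch u) * (1 + u * a)^-1)%:E =
   \int[mu]_(s in `[0%R, +oo[) (\1_W s * first_branch_density s)%:E)%E.
Proof.
move=> mW; rewrite -[LHS]m1E -[RHS]m2E.
have mm1 : measurable_fun setT (first_branch : measurableTypeR R -> measurableTypeR R).
  exact: measurable_first_branch.
pose M1 : {measure set (measurableTypeR R) -> \bar R} :=
  measure_function_pushforward__canonical__measure_function_Measure
    (density_measure mu mf1 f10) mm1.
pose M2 : {measure set (measurableTypeR R) -> \bar R} := density_measure mu mf2 f20.
apply: (@measure_unique _ R (measurableTypeR R) (@RGenInftyO.G R)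
  (fun k => `]-oo, k.+1%:R[%classic) _ _ _ _ M1 M2) => //.
- exact: RGenInftyO.measurableE.
- move=> _ _ [x ->] [y ->]; exists (Num.min x y).
  by apply/seteqP; split => z /=; rewrite !in_itv/= lt_min => /andP.
- by move=> k; exists k.+1%:R.
- apply/seteqP; split => // x _; exists (Num.truncn x) => //=.
  by rewrite in_itv/=; exact: truncnS_gt.
(* Both measures live on the nonnegative half-line, so a ray with [y <= 0] has mass zero. *)
- move=> _ [y ->]; have [y0|y0] := ltP 0 y.
    by have [x [xm1 xm2]] := ray y0; exact: etrans xm1 (esym xm2).
  transitivity (0 : \bar R)%E; [transitivity (m1 `]-oo, y[%classic)|
    transitivity (m2 `]-oo, y[%classic)] => //; [rewrite m1E|rewrite m2E];
    rewrite integral0_eq// => u /=; rewrite in_itv/= => u01; rewrite indicE memNset ?mul0r//=;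
    rewrite in_itv/=; apply/negP; rewrite -leNgt (le_trans y0)//.
  + case/andP: u01 => u0 u1; apply: mulr_ge0; first by rewrite invr_ge0 ltW.
    by rewrite subr_ge0 invf_ge1.
  + by case/andP: u01.
- move=> k; have [x [xm1 _]] := ray (ltr0Sn R k).
  by rewrite (_ : M1 _ = x%:E)// ltry.
Qed.

End fibre.

Section rho_invariant.
Context (R : realType).
Local Notation mu := (@lebesgue_measure R).
Local Notation plane := (measurableTypeR R * measurableTypeR R)%type.
Local Notation Rm := (measurableTypeR R).

Lemma measurable_F : measurable_fun setT (@F R : plane -> plane).
Proof.
have m1 : measurable_fun setT (fst : plane -> Rm) by exact: measurable_fst.
have m2 : measurable_fun setT (snd : plane -> Rm) by exact: measurable_snd.
have mi : measurable_fun setT (@GRing.inv R : Rm -> Rm) by exact: measurable_inv.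
apply: measurable_fun_ifT; first exact: measurable_fun_ltr.
  apply: measurable_fun_pair => //; apply: measurable_funM; first exact: measurableT_comp.
  by apply: measurable_funB => //; exact: measurableT_comp.
by apply: measurable_fun_pair => //; exact: measurable_funB.
Qed.

Lemma measurable_rho_density : measurable_fun setT (@rho_density R : plane -> Rm).
Proof.
have m1 : measurable_fun setT (fst : plane -> Rm) by exact: measurable_fst.
have m2 : measurable_fun setT (snd : plane -> Rm) by exact: measurable_snd.
apply: (measurableT_comp (@measurable_inv R)).
by apply: measurable_funD => //; exact: measurable_funM.
Qed.

Lemma measurable_Sigma : measurable (@Sigma R : set plane).
Proof. by apply: measurableX; exact: measurable_itv. Qed.

Lemma rho_density_ge0 (p : R * R) : Sigma p -> 0 <= rho_density p.
Proof.
case: p => u v [/=]; rewrite !in_itv/= => /andP[u0 _]; rewrite andbT => v0.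
by rewrite invr_ge0 addr_ge0// mulr_ge0// ltW.
Qed.

Let w (A : set plane) (p : plane) : \bar R := (\1_A p * rho_density p)%:E.

Let mw (A : set plane) (D : set plane) : measurable A -> measurable_fun D (w A).
Proof.
move=> mA; apply/measurable_funTS/measurable_EFinP; apply: measurable_funM.
  exact: measurable_indic.
exact: measurable_rho_density.
Qed.

Let w0 A p : Sigma p -> (0 <= w A p)%E.
Proof. by move=> pS; rewrite lee_fin mulr_ge0// rho_density_ge0. Qed.

Let rhoE (A : set plane) : rho A = (\int[mu \x mu]_(p in @Sigma R) w A p)%E.
Proof.
rewrite /rho integral_mkcondl; apply: eq_integral => p _.
by rewrite patchE /w indicE; case: (p \in A); rewrite ?mul1r ?mul0r.
Qed.

Let rho_iter1 A : measurable A ->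
  rho A = (\int[mu]_(u in `]0%R, 1%R]) \int[mu]_(v in `[0%R, +oo[) w A (u, v))%E.
Proof.
by move=> mA; rewrite rhoE tonelli_rectangle1//; [exact: mw|exact: w0].
Qed.

Let rho_iter2 A : measurable A ->
  rho A = (\int[mu]_(v in `[0%R, +oo[) \int[mu]_(u in `]0%R, 1%R]) w A (u, v))%E.
Proof.
by move=> mA; rewrite rhoE tonelli_rectangle2//; [exact: mw|exact: w0].
Qed.

Let m1 : measurable_fun setT (fst : plane -> Rm). Proof. exact: measurable_fst. Qed.
Let m2 : measurable_fun setT (snd : plane -> Rm). Proof. exact: measurable_snd. Qed.

(** [k1] and [k2] are the densities of the images of [rho] under the first and second branch; that
    they add up to [rho_density] is the infinitesimal form of invariance. *)
Let k1 (p : plane) : R := first_branch_density p.1 p.2.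
Let k2 (p : plane) : R := (1 + p.1 * (p.2 + 1))^-1.

Let mk1 : measurable_fun setT (k1 : plane -> Rm).
Proof.
apply: measurable_funM => //; apply: (measurableT_comp (@measurable_inv R)).
have m12 : measurable_fun setT (fun p : plane => p.1 * p.2 : Rm) by exact: measurable_funM.
by apply: measurable_funM; repeat apply: measurable_funD => //.
Qed.

Let mk2 : measurable_fun setT (k2 : plane -> Rm).
Proof.
apply: (measurableT_comp (@measurable_inv R)); apply: measurable_funD => //.
by apply: measurable_funM => //; exact: measurable_funD.
Qed.

Let rect : set plane := `]0%R, 1%R] `*` `[0%R, +oo[.

Let rectP p : rect p -> 0 < p.1 /\ 0 <= p.2.
Proof. by move=> [/=]; rewrite !in_itv/= => /andP[-> _]; rewrite andbT => ->. Qed.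

Let k1_ge0 p : rect p -> 0 <= k1 p.
Proof. by move=> /rectP[? ?]; exact: first_branch_density_ge0. Qed.

Let k2_ge0 p : rect p -> 0 <= k2 p.
Proof.
move=> /rectP[/ltW ? ?]; rewrite invr_ge0.
by rewrite addr_ge0// mulr_ge0// addr_ge0.
Qed.

Let k12 p : rect p -> k1 p + k2 p = rho_density p.
Proof.
case: p => u v /rectP[/= u0 v0]; rewrite /k1 /k2 /first_branch_density /rho_density/=.
have uv0 : 0 < 1 + u * v by rewrite ltr_wpDr// mulr_ge0// ltW.
have uv1 : 0 < 1 + u * (v + 1) by rewrite mulrDr mulr1 addrA addr_gt0.
by field; rewrite !gt_eqF.
Qed.

Variables (E : set plane) (mE : measurable E).

Let g k p := (\1_E p * k p : R)%:E.

Let mg (k : plane -> R) D : measurable_fun setT (k : plane -> Rm) ->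
  measurable_fun D (g k).
Proof.
move=> mk; apply/measurable_funTS/measurable_EFinP; apply: measurable_funM => //.
Qed.

Let g0 k p : 0 <= k p -> (0 <= g k p)%E.
Proof. by move=> k0; rewrite lee_fin mulr_ge0. Qed.

Let mFE : measurable (@F R @^-1` E : set plane).
Proof. by rewrite -[X in measurable X]setTI; exact: measurable_F. Qed.

Let branch1 :
  (\int[mu]_(v in `[0%R, 1%R[) \int[mu]_(u in `]0%R, 1%R]) w (@F R @^-1` E) (u, v) =
   \int[mu]_(u in `]0%R, 1%R]) \int[mu]_(s in `[0%R, +oo[) g k1 (u, s))%E.
Proof.
(* Both outer integrals are brought to the open interval []0, 1[]: the fibre lemma needs [0 < v] and
   the first branch needs [v < 1]. *)
rewrite -integral_itv_obnd_cbnd; last first.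
  apply: measurable_funS (measurable_itv `[0%R, +oo[) _ _.
    by move=> v /=; rewrite !in_itv/= => /andP[/ltW -> _].
  apply: (@measurable_tonelli_rectangle2 _ _ _ _ _ mu `]0%R, 1%R] _ (w (@F R @^-1` E))) => //.
    exact: mw.
  exact: w0.
rewrite -[RHS]integral_itv_bndo_bndc; last first.
  apply: measurable_funS (measurable_itv `]0%R, 1%R]) _ _.
    by move=> v /=; rewrite !in_itv/= => /andP[-> /ltW ->].
  by apply: (@measurable_tonelli_rectangle1 _ _ _ _ _ mu _ `[0%R, +oo[ (g k1)) => [|||p pr] //;
    [exact: mg|apply: g0; exact: k1_ge0].
apply: eq_integral => v /set_mem/=; rewrite in_itv/= => /andP[v0 v1].
have mW : measurable (xsection E v) by exact: measurable_xsection.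
transitivity (\int[mu]_(u in `]0%R, 1%R])
   (\1_(xsection E v) (first_branch v u) * (1 + u * v)^-1)%:E)%E.
  apply: eq_integral => u _; rewrite /w /rho_density/= !indicE.
  congr (_ * _)%:E; congr (nat_of_bool _)%:R; rewrite mem_xsection.
  have FE : F (u, v) = (v, first_branch v u) by rewrite /F/= v1.
  by apply/idP/idP => /set_mem H; apply/mem_set; move: H; rewrite /preimage/= FE.
rewrite first_branch_fibre//; apply: eq_integral => s _.
by rewrite /g /k1/= !indicE mem_xsection.
Qed.

Let branch2 :
  (\int[mu]_(v in `[1%R, +oo[) \int[mu]_(u in `]0%R, 1%R]) w (@F R @^-1` E) (u, v) =
   \int[mu]_(u in `]0%R, 1%R]) \int[mu]_(s in `[0%R, +oo[) g k2 (u, s))%E.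
Proof.
have sub : `]0%R, 1%R] `*` `[1%R, +oo[ `<=` @Sigma R.
  move=> [u v] [/= u01]; rewrite in_itv/= andbT => v1; split => //=.
  by rewrite in_itv/= andbT (le_trans _ v1).
rewrite -(@tonelli_rectangle2 _ _ _ _ _ mu mu _ _ (w (@F R @^-1` E)))//; last 2 first.
- exact: mw.
- by move=> p /sub; exact: w0.
rewrite tonelli_rectangle1//; last 2 first.
- exact: mw.
- by move=> p /sub; exact: w0.
apply: eq_integral => u /set_mem/= u01.
rewrite (@ge0_integral_shift _ 1)//; last 2 first.
- apply: measurable_funTS; apply: (measurableT_comp (f := w (@F R @^-1` E))).
    exact: mw.
  by apply: measurable_fun_pair.
- by move=> v v1; apply: w0; exact: sub.
rewrite (_ : _ @^-1` _ = `[0%R, +oo[%classic); last first.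
  by apply/seteqP; split => v /=; rewrite !in_itv/= !andbT -lerBlDr subrr.
apply: eq_integral => s /set_mem/=; rewrite in_itv/= andbT => s0.
rewrite /w /g /k2 /rho_density/= !indicE; congr (_ * _)%:E; congr (nat_of_bool _)%:R.
have FE : F (u, s + 1) = (u, s) by rewrite /F/= ltNge lerDr s0/= addrK.
by apply/idP/idP => /set_mem H; apply/mem_set; move: H; rewrite /preimage/= FE.
Qed.

Lemma rho_F : rho (@F R @^-1` E) = rho E.
Proof.
rewrite rho_iter2//.
have -> : `[0%R, +oo[%classic = `[0%R, 1%R[ `|` `[1%R, +oo[ :> set R.
  by rewrite -itv_bndbnd_setU// bnd_simp.
rewrite ge0_integral_setU//=; last 3 first.
- rewrite -itv_bndbnd_setU ?bnd_simp//.
  apply: (@measurable_tonelli_rectangle2 _ _ _ _ _ mu `]0%R, 1%R] _ (w (@F R @^-1` E))) => //.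
    exact: mw.
  exact: w0.
- move=> v v0; apply: integral_ge0 => u u01; apply: w0; split => //=.
  case: v0 => /=; rewrite !in_itv/= andbT; first by case/andP.
  by move=> v1; rewrite (le_trans _ v1).
- apply/disj_setPLR => v /=; rewrite !in_itv/= => /andP[_ v1].
  by rewrite andbT; apply/negP; rewrite -ltNge.
rewrite branch1 branch2 -ge0_integralD//; last 4 first.
- by move=> u u01; apply: integral_ge0 => s s0; apply: g0; apply: k1_ge0.
- by apply: (@measurable_tonelli_rectangle1 _ _ _ _ _ mu _ `[0%R, +oo[ (g k1)) => [|||p pr] //;
    [exact: mg|apply: g0; exact: k1_ge0].
- by move=> u u01; apply: integral_ge0 => s s0; apply: g0; apply: k2_ge0.
- by apply: (@measurable_tonelli_rectangle1 _ _ _ _ _ mu _ `[0%R, +oo[ (g k2)) => [|||p pr] //;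
    [exact: mg|apply: g0; exact: k2_ge0].
rewrite rho_iter1//; apply: eq_integral => u /set_mem u01.
rewrite -ge0_integralD//; last 4 first.
- by move=> s s0; apply: g0; apply: k1_ge0.
- by apply/measurable_funTS/measurable_fun_pair2; exact: mg.
- by move=> s s0; apply: g0; apply: k2_ge0.
- by apply/measurable_funTS/measurable_fun_pair2; exact: mg.
apply: eq_integral => s /set_mem s0.
by rewrite /g /w -EFinD -mulrDr k12.
Qed.

End rho_invariant.

(** * Invariant sets of finite measure *)

Section rho_null.
Context (R : realType).
Local Notation mu := (@lebesgue_measure R).
Local Notation plane := (measurableTypeR R * measurableTypeR R)%type.
Local Notation Rm := (measurableTypeR R).
Local Notation mu2 := (mu \x mu)%E.

(** The second branch of [F] translates each stripe onto the one below it. *)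
Definition stripe (k : nat) : set plane := `]0%R, 1%R] `*` `[k%:R, k.+1%:R[.

Lemma measurable_stripe k : measurable (stripe k).
Proof. by apply: measurableX; exact: measurable_itv. Qed.

Lemma stripe_Sigma k : stripe k `<=` @Sigma R.
Proof.
move=> [u v] [/= u01]; rewrite in_itv/= => /andP[kv _]; split => //=.
by rewrite in_itv/= andbT (le_trans _ kv).
Qed.

Lemma trivIset_stripe : trivIset setT stripe.
Proof.
apply/trivIsetP => i j _ _ ij; apply/seteqP; split => // -[u v] [[_ /= iv] [_ /= jv]].
move: iv jv; rewrite !in_itv/= => /truncn_def iE /truncn_def jE.
by move: ij; rewrite -iE -jE eqxx.
Qed.

Lemma bigcup_stripe : \bigcup_k stripe k = @Sigma R.
Proof.
apply/seteqP; split; first by move=> p [k _]; exact: stripe_Sigma.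
move=> [u v] [/= u01]; rewrite in_itv/= andbT => v0.
by exists (Num.truncn v) => //; split => //=; rewrite in_itv/=; exact: truncn_itv.
Qed.

Lemma rho_setCSigma : rho (~` @Sigma R : set plane) = 0%E.
Proof. by rewrite /rho setICl integral_set0. Qed.

Lemma rho_le_lebesgue (A : set plane) : measurable A ->
  (rho A <= mu2 (A `&` @Sigma R))%E.
Proof.
move=> mA; have mAS : measurable (A `&` @Sigma R).
  by apply: measurableI => //; exact: measurable_Sigma.
rewrite -[leRHS]mul1e -integral_cst//; apply: ge0_le_integral => //.
- by move=> p [_ pS]; rewrite lee_fin rho_density_ge0.
- by apply/measurable_funTS/measurable_EFinP; exact: measurable_rho_density.
- move=> [u v] [_ [/=]]; rewrite !in_itv/= => /andP[u0 _]; rewrite andbT => v0.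
  by rewrite lee_fin invf_le1 ?lerDl ?mulr_ge0// ?ltr_wpDr// ?mulr_ge0// ltW.
Qed.

(** On the stripe [u <= 1] and [v < k + 1], so [1 + u v < k + 2]. *)
Lemma lebesgue_stripe_le_rho (A : set plane) k : measurable A ->
  ((k.+2%:R^-1)%:E * mu2 (A `&` stripe k) <= rho (A `&` stripe k))%E.
Proof.
move=> mA; have mAS : measurable (A `&` stripe k).
  by apply: measurableI => //; exact: measurable_stripe.
rewrite -integral_cst// /rho (setIidl (_ : A `&` stripe k `<=` @Sigma R)); last first.
  by move=> p [_]; exact: stripe_Sigma.
apply: ge0_le_integral => //.
- by move=> p _; rewrite lee_fin.
- by apply/measurable_funTS/measurable_EFinP; exact: measurable_rho_density.
- move=> [u v] [_ [/=]]; rewrite !in_itv/= => /andP[u0 u1] /andP[v0 v1].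
  have v0' : 0 <= v by rewrite (le_trans _ v0).
  rewrite lee_fin lef_pV2 ?posrE ?ltr_wpDr ?mulr_ge0// 1?ltW//.
  rewrite /= -(natr1 k.+1) addrC ltrD2r (le_lt_trans _ v1)//.
  by rewrite ler_piMl.
Qed.

Lemma lebesgue_stripe_shift (B : set plane) k : measurable B ->
  @F R @^-1` B = B -> mu2 (B `&` stripe k.+1) = mu2 (B `&` stripe k).
Proof.
move=> mB FB.
have mI D : measurable_fun D (fun p : plane => (\1_B p : R)%:E).
  by apply/measurable_funTS/measurable_EFinP; exact: measurable_indic.
have stripeE i : mu2 (B `&` stripe i) =
    (\int[mu]_(u in `]0%R, 1%R]) \int[mu]_(v in `[i%:R, i.+1%:R[) (\1_B (u, v))%:E)%E.
  rewrite -integral_indic//; last exact: measurable_stripe.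
  by rewrite tonelli_rectangle1.
rewrite !stripeE; apply: eq_integral => u /set_mem u01.
rewrite (@ge0_integral_shift _ 1)//; last first.
  by apply: measurable_funTS; exact: measurable_fun_pair2 (mI setT).
rewrite (_ : _ @^-1` _ = `[k%:R, k.+1%:R[%classic); last first.
  by apply/seteqP; split => v /=; rewrite !in_itv/= -(natr1 k.+1) ltrD2r
    -[X in (X <= v + 1)%R]natr1 lerD2r.
apply: eq_integral => v /set_mem/=; rewrite in_itv/= => /andP[kv _].
have v0 : 0 <= v by rewrite (le_trans _ kv).
congr EFin; rewrite !indicE; congr (nat_of_bool _)%:R.
have FE : F (u, v + 1) = (u, v) by rewrite /F/= ltNge lerDr v0/= addrK.
have BE : B (u, v + 1) = B (u, v) by rewrite -[in LHS]FB /preimage/= FE.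
by apply/idP/idP => /set_mem H; apply/mem_set; [rewrite -BE|rewrite BE].
Qed.

(* A set invariant under [F] is 1-periodic in [v], and [rho] gives the [k]-th
   period at least [1 / (k + 2)] of its area. *)
Lemma rho_invariant_null (B : set plane) : measurable B ->
  @F R @^-1` B = B -> (rho B < +oo)%E -> rho B = 0%E.
Proof.
move=> mB FB finB.
have muE k : mu2 (B `&` stripe k) = mu2 (B `&` stripe 0).
  by elim: k => // k <-; exact: lebesgue_stripe_shift.
have mBs k : measurable (B `&` stripe k).
  by apply: measurableI => //; exact: measurable_stripe.
have BS : B `&` @Sigma R = \bigcup_k (B `&` stripe k).
  by rewrite -bigcup_stripe setI_bigcupr.
have [b0|b0] := eqVneq (mu2 (B `&` stripe 0)) 0%E.
  apply/eqP; rewrite eq_le measure_ge0 andbT (le_trans (rho_le_lebesgue mB))//.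
  rewrite BS (le_trans (measure_sigma_subadditive _ _ _ (fun p H => H)))//.
  - exact: bigcupT_measurable.
  - by rewrite eseries0// => k _ _; rewrite /= muE.
exfalso.
have sumB n : (\sum_(k < n) (k.+2%:R^-1)%:E * mu2 (B `&` stripe 0) <= rho B)%E.
  apply: (@le_trans _ _ (\sum_(k < n) rho (B `&` stripe k))%E).
    by apply: lee_sum => k _; rewrite -(muE k); exact: lebesgue_stripe_le_rho.
  have mU : measurable (\big[setU/set0]_(k < n) (B `&` stripe k)).
    exact: bigsetU_measurable.
  have tI : trivIset `I_n (fun k => B `&` stripe k).
    by apply: trivIset_setIl; apply: sub_trivIset trivIset_stripe.
  have <- := @measure_semi_additive_ord_I _ _ _ (@rho R) _ n (fun k _ => mBs k) tI mU.
  apply: le_measure; rewrite ?inE//.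
  by move=> p; rewrite -(bigcup_mkord n (fun k => B `&` stripe k)) => -[k _ []].
set beta := mu2 _ in b0 sumB.
have beta0 : (0 <= beta)%E by exact: measure_ge0.
(* The lowest stripe alone gives [beta / 2 <= rho B]. *)
have finbeta : beta \is a fin_num.
  rewrite ge0_fin_numE// ltey; apply/eqP => betay.
  have := sumB 1%N; rewrite big_ord1 betay gt0_muley ?lte_fin//.
  by move/(lt_le_trans finB); rewrite ltxx.
have finrho : rho B \is a fin_num by rewrite ge0_fin_numE//; exact: measure_ge0.
have beta_gt0 : 0 < fine beta by rewrite fine_gt0// lt0e b0 beta0 ltey_eq finbeta.
apply: (@dvg_harmonic R); apply: nondecreasing_is_cvgn.
  apply/nondecreasing_seqP => n; rewrite /series/= big_nat_recr//= lerDl.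
  by rewrite invr_ge0.
(* The extra [1] is the first harmonic term, absent from the sum of the [1 / (k + 2)]. *)
exists (1 + fine (rho B) / fine beta) => _ [n _ <-].
rewrite (@le_trans _ _ (series harmonic n.+1))//.
  by rewrite /series/= [leRHS]big_nat_recr//= lerDl invr_ge0.
rewrite /series/= big_nat_recl//= invr1 lerD2l ler_pdivlMr// big_mkord.
rewrite -lee_fin EFinM !fineK// (le_trans _ (sumB n))// -sumEFin.
by rewrite ge0_sume_distrl// => k _; rewrite lee_fin invr_ge0.
Qed.

End rho_null.

(** * Frequency of visits to a set of finite measure *)

Section visits.
Context d (T : measurableType d) (R : realType) (mu : {measure set T -> \bar R}).
Variables (f : T -> T) (mf : measurable_fun setT f).
Hypothesis inv_f : forall E, measurable E -> mu (f @^-1` E) = mu E.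
Variables (A : set T) (mA : measurable A) (c : nat).

Definition visits (n : nat) (p : T) : nat := \sum_(k < n) (iter k f p \in A).

Lemma visitsS n p : visits n.+1 p = ((p \in A) + visits n (f p))%N.
Proof.
rewrite /visits big_ord_recl/=; congr addn.
by apply: eq_bigr => i _; rewrite -iterSr.
Qed.

(** Infinitely many times [m] see at least about [m / c] visits. The free offset [K] makes the set
    exactly invariant: one step of [f] changes [m] by one and the count by at most one, which
    [K + 1] or [K + c] absorbs. *)
Definition frequent : set T := [set p | exists K, forall n,
  exists2 m, (n <= m)%N & (m <= c * visits m p + K)%N].

Lemma measurable_iter k : measurable_fun setT (iter k f).
Proof.
elim: k => [|k IH]; first exact: measurable_id.
by have := measurableT_comp mf IH.
Qed.

Lemma measurable_frequent : measurable frequent.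
Proof.
rewrite (_ : frequent = \bigcup_K \bigcap_n \bigcup_(m >= n)
    [set p | (m <= c * visits m p + K)%N]); last first.
  apply/seteqP; split => p.
    by move=> [K HK]; exists K => // n _; have [m nm mK] := HK n; exists m.
  by move=> [K _ HK]; exists K => n; have [m nm mK] := HK n Logic.I; exists m.
apply: bigcupT_measurable => K; apply: bigcapT_measurable => n.
apply: bigcup_measurable => m _.
have mg : measurable_fun setT (fun p => c%:R * \sum_(k < m) \1_A (iter k f p) : R).
  apply: measurable_funM => //; apply: measurable_sum => k.
  by apply: measurableT_comp; [exact: measurable_indic|exact: measurable_iter].
rewrite (_ : [set p | _] =
  (fun p => c%:R * \sum_(k < m) \1_A (iter k f p) : R)
    @^-1` `[m%:R - K%:R, +oo[); last first.
  apply/seteqP; split => p /=; rewrite in_itv/= andbT lerBlDr;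
    by under eq_bigr do rewrite indicE; rewrite -natr_sum -natrM -natrD ler_nat.
by rewrite -[X in measurable X]setTI; exact: mg.
Qed.

Lemma frequent_invariant : f @^-1` frequent = frequent.
Proof.
apply/seteqP; split => p [K HK].
  exists (K + 1)%N => n; have [m nm mK] := HK n.
  exists m.+1; rewrite ?(leq_trans nm)// visitsS addn1 addnS ltnS.
  by rewrite (leq_trans mK)// leq_add2r leq_mul2l leq_addl orbT.
exists (K + c)%N => n; have [[//|m] nm mK] := HK n.+1.
exists m => //; move: mK; rewrite visitsS mulnDr => /ltnW/leq_trans; apply.
apply: (@leq_trans (c + c * visits m (f p) + K)).
  by rewrite !leq_add2r; case: (_ \in A); rewrite ?muln1 ?muln0.
by rewrite -addnA addnC -addnA.
Qed.

(** With [c + 1] in place of [c], a sum over [m] steps from a frequent point is at least the number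
    of visits minus [K], hence eventually positive. The invariant factor [\1_frequent] kills every
    sum off the set. *)
Let g (p : T) : R := \1_frequent p * (c.+1%:R * \1_A p - 1).

(** Unfolded, this is the maximum of the sums of [g] over the first [j] orbit points, for
    [0 <= j <= n]. *)
Fixpoint garsia (n : nat) (p : T) : R :=
  if n is n'.+1 then Num.max 0 (g p + garsia n' (f p)) else 0.

Lemma garsia_ge0 n p : 0 <= garsia n p.
Proof. by case: n => //= n; rewrite le_max lexx. Qed.

Lemma measurable_garsia n : measurable_fun setT (garsia n).
Proof.
elim: n => [|n IH] /=; first exact: measurable_cst.
apply: measurable_maxr => //; apply: measurable_funD; last exact: measurableT_comp.
apply: measurable_funM; first by apply: measurable_indic; exact: measurable_frequent.
apply: measurable_funB => //; apply: measurable_funM => //; exact: measurable_indic.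
Qed.

Lemma garsia_leS n p : garsia n p <= garsia n.+1 p.
Proof.
elim: n p => [|n IH] p; first exact: garsia_ge0.
rewrite [leLHS]/= ge_max garsia_ge0/= le_max.
by apply/orP; right; rewrite lerD2l IH.
Qed.

Lemma frequent_f p : frequent (f p) <-> frequent p.
Proof. by rewrite -[X in _ <-> X p]frequent_invariant. Qed.

Lemma garsia_notin n p : ~ frequent p -> garsia n p = 0.
Proof.
elim: n p => //= n IH p pB; rewrite IH; last by move/frequent_f.
by rewrite addr0 /g indicE memNset// mul0r maxxx.
Qed.

(** Where [garsia n.+1] is positive, it equals [g p + garsia n (f p)] and [p] is frequent. The [-1]
    of [g] is moved to the left as an indicator, so that every term is nonnegative and can be
    integrated. *)
Lemma garsia_step n p :
  \1_[set p | 0 < garsia n.+1 p] p + garsia n.+1 p <=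
  c.+1%:R * \1_A p + garsia n.+1 (f p).
Proof.
have r0 : 0 <= c.+1%:R * \1_A p + garsia n.+1 (f p).
  by rewrite addr_ge0// ?mulr_ge0// garsia_ge0.
have [gp|gp] := ltP 0 (garsia n.+1 p); last first.
  have -> : garsia n.+1 p = 0 by apply/eqP; rewrite eq_le gp garsia_ge0.
  by rewrite indicE memNset//= ?addr0// => /lt_geF; rewrite gp.
rewrite indicE mem_set//=.
have pB : frequent p.
  by apply: contrapT => /(garsia_notin n.+1) g0; rewrite g0 ltxx in gp.
move: gp => /=; rewrite lt_max ltxx/= => gp.
rewrite (max_idPr (ltW gp)) /g indicE mem_set// mul1r.
have /= := garsia_leS n (f p).
set a := _ * _; set b := garsia n (f p); set e := Num.max _ _; lra.
Qed.

Lemma garsia_le n p : garsia n.+1 p <= c.+1%:R * \1_A p + garsia n (f p).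
Proof.
rewrite /= ge_max addr_ge0 ?mulr_ge0 ?garsia_ge0//= lerD2r /g indicE.
case: (p \in _); rewrite ?mul0r ?mul1r ?mulr_ge0//.
by rewrite lerBlDr lerDl.
Qed.

Lemma visits_le_garsia n p : frequent p ->
  c.+1%:R * (visits n p)%:R - n%:R <= garsia n p.
Proof.
elim: n p => [|n IH] p pB; first by rewrite /visits big_ord0 mulr0 subr0.
rewrite /= le_max visitsS; apply/orP; right.
have := IH (f p) (proj2 (frequent_f p) pB).
rewrite /g !indicE (mem_set pB) mul1r natrD mulrDr -natr1.
set a := _ * _; set b := _ * _; set e := garsia _ _; lra.
Qed.

Lemma garsia_pos p : frequent p -> exists n, 0 < garsia n.+1 p.
Proof.
(* A time beyond [c * K + K] forces more than [K] visits, whence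
   [c * visits + K < (c + 1) * visits]. *)
move=> pB; have [K HK] := pB; have [[//|n] nK nV] := HK (c * K + K).+1.
exists n; rewrite (lt_le_trans _ (visits_le_garsia n.+1 pB))//.
rewrite subr_gt0 -natrM ltr_nat mulSn.
have KV : (K < visits n.+1 p)%N.
  rewrite ltnNge; apply/negP => VK; move: nK; rewrite ltnNge => /negP; apply.
  by rewrite (leq_trans nV)// leq_add2r leq_mul2l VK orbT.
by rewrite (leq_ltn_trans nV)// addnC ltn_add2r.
Qed.

Lemma integral_comp_invariant (k : T -> \bar R) : measurable_fun setT k ->
  (forall p, 0 <= k p)%E -> (\int[mu]_p k (f p) = \int[mu]_p k p)%E.
Proof.
move=> mk k0.
have := @ge0_integral_pushforward _ _ T T R f mf mu setT k.
rewrite preimage_setT => /= <-//.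
apply: eq_measure_integral => E mE _.
exact: inv_f.
Qed.

Hypothesis finA : (mu A < +oo)%E.

Let iA : (\int[mu]_p (c.+1%:R * \1_A p)%:E = c.+1%:R%:E * mu A)%E.
Proof.
under eq_integral do rewrite EFinM.
rewrite ge0_integralZl//; first by rewrite integral_indic// setIT.
by apply/measurable_EFinP; exact: measurable_indic.
Qed.

Let mEgarsia n : measurable_fun setT (fun p => (garsia n p)%:E).
Proof. by apply/measurable_EFinP; exact: measurable_garsia. Qed.

Let mcA : measurable_fun setT (fun p => (c.+1%:R * \1_A p : R)%:E).
Proof.
by apply/measurable_EFinP; apply: measurable_funM => //; exact: measurable_indic.
Qed.

Let finiA : (c.+1%:R%:E * mu A < +oo)%E.
Proof. by rewrite lte_mul_pinfty// lee_fin. Qed.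

(** Each step adds at most [(c + 1) * mu A]. Finiteness is what permits cancellation in the extended
    reals. *)
Lemma garsia_integral n : (\int[mu]_p (garsia n p)%:E < +oo)%E.
Proof.
elim: n => [|n IH]; first by rewrite integral0.
apply: (@le_lt_trans _ _ (\int[mu]_p ((c.+1%:R * \1_A p)%:E + (garsia n (f p))%:E)))%E.
  apply: ge0_le_integral => //.
  - by move=> p _; rewrite lee_fin garsia_ge0.
  - by apply: emeasurable_funD => //; exact: (measurableT_comp (mEgarsia n)).
  - by move=> p _; rewrite -EFinD lee_fin garsia_le.
rewrite ge0_integralD//; last 2 first.
- by move=> p _; rewrite lee_fin garsia_ge0.
- exact: (measurableT_comp (mEgarsia n)).
rewrite iA (integral_comp_invariant (mEgarsia n))//; last first.
  by move=> p; rewrite lee_fin garsia_ge0.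
by rewrite lte_add_pinfty.
Qed.

Let mpos n : measurable [set p | 0 < garsia n.+1 p].
Proof.
rewrite (_ : [set _ | _] = garsia n.+1 @^-1` `]0, +oo[).
  by rewrite -[X in measurable X]setTI; exact: measurable_garsia.
by apply/seteqP; split => p /=; rewrite in_itv/= andbT.
Qed.

(* Garsia's argument: [garsia] is the maximal function of the Birkhoff sums of
   [g], so integrating [garsia_step] cancels the two equal finite integrals. *)
Lemma garsia_pos_le n : (mu [set p | 0 < garsia n.+1 p]%R <= c.+1%:R%:E * mu A)%E.
Proof.
have fin : (\int[mu]_p (garsia n.+1 p)%:E)%E \is a fin_num.
  rewrite ge0_fin_numE ?garsia_integral// integral_ge0// => p _.
  by rewrite lee_fin garsia_ge0.
rewrite -(leeD2rE _ _ fin) -{1}[X in mu X]setIT -integral_indic//.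
rewrite -{2}(integral_comp_invariant (mEgarsia n.+1)); last first.
  by move=> p; rewrite lee_fin garsia_ge0.
have mi : measurable_fun setT (fun p => (\1_[set p | 0 < garsia n.+1 p] p : R)%:E).
  by apply/measurable_EFinP; exact: measurable_indic.
have mgf := measurableT_comp (mEgarsia n.+1) mf.
rewrite -iA -!ge0_integralD//; try by move=> p _; rewrite lee_fin garsia_ge0.
apply: ge0_le_integral => //.
- by move=> p _; rewrite adde_ge0// lee_fin garsia_ge0.
- exact: emeasurable_funD.
- exact: emeasurable_funD.
- by move=> p _; rewrite -!EFinD lee_fin garsia_step.
Qed.

(** The set is the increasing union of the sets where [garsia n.+1] is positive, whose measures
    share one bound. *)
Lemma frequent_finite : (mu frequent < +oo)%E.
Proof.
apply: (@le_lt_trans _ _ (c.+1%:R%:E * mu A)%E) => //.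
have -> : frequent = \bigcup_n [set p | 0 < garsia n.+1 p].
  apply/seteqP; split => p; first by move=> /garsia_pos[n ?]; exists n.
  move=> [n _ gp]; apply: contrapT => /(garsia_notin n.+1) g0.
  by move: gp; rewrite /mkset g0 ltxx.
have cv : mu \o (fun n => [set p | 0 < garsia n.+1 p]) @ \oo -->
    mu (\bigcup_n [set p | 0 < garsia n.+1 p]).
  apply: nondecreasing_cvg_mu => //; first exact: bigcupT_measurable.
  apply/nondecreasing_seqP => n; apply/subsetPset => p /lt_le_trans; apply.
  exact: garsia_leS.
rewrite -(cvg_lim _ cv)//; apply: lime_le; first by apply/cvg_ex; eexists; exact: cv.
by apply: nearW => n; exact: garsia_pos_le.
Qed.

End visits.

(** * Birkhoff sums along an orbit *)

Section orbit.
Context {R : realType}.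
Local Notation mu := (@lebesgue_measure R).
Local Notation plane := (measurableTypeR R * measurableTypeR R)%type.
Variable h : R -> R.

(** The bounded [psi] solving the cohomological equation: the sum over [j < i] has unit difference
    [h v - h (v + i)], and averaging over [i < m] produces the window average. *)
Definition window_primitive (m : nat) (v : R) : R :=
  m%:R^-1 * \sum_(i < m) \sum_(j < i) h (v + j%:R).

Lemma window_primitiveB m v : (0 < m)%N ->
  window_primitive m v - window_primitive m (v + 1) =
  h v - m%:R^-1 * \sum_(i < m) h (v + i%:R).
Proof.
move=> m0; have mR : m%:R != 0 :> R by rewrite pnatr_eq0 -lt0n.
rewrite /window_primitive -mulrBr -sumrB.
have tel i : \sum_(j < i) h (v + j%:R) - \sum_(j < i) h (v + 1 + j%:R) =
    h v - h (v + i%:R).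
  rewrite -sumrB; elim: i => [|i IH]; first by rewrite big_ord0 addr0 subrr.
  by rewrite big_ord_recr/= IH addrA subrK -addrA (addrC 1) natr1.
under eq_bigr do rewrite tel.
by rewrite sumrB mulrBr sumr_const card_ord -[h v *+ m]mulr_natl mulKf.
Qed.

Lemma window_primitive_le C m v : (0 < m)%N -> (forall x, `|h x| <= C) ->
  `|window_primitive m v| <= m%:R * C.
Proof.
move=> m0 hC; have mR : 0 < m%:R :> R by rewrite ltr0n.
have C0 : 0 <= C by exact: le_trans (hC 0).
rewrite /window_primitive normrM gtr0_norm ?invr_gt0// ler_pdivrMl//.
rewrite (le_trans (ler_norm_sum _ _ _))//.
rewrite [leRHS](_ : _ = \sum_(i < m) m%:R * C); last first.
  by rewrite sumr_const card_ord; exact: mulr_natl.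
apply: ler_sum => i _; rewrite (le_trans (ler_norm_sum _ _ _))//.
rewrite (@le_trans _ _ (\sum_(j < i) C))//; first by apply: ler_sum.
by rewrite sumr_const card_ord -[leLHS]mulr_natl ler_wpM2r// ler_nat ltnW.
Qed.

Variables (g : R -> R) (G C M kappa e : R) (m : nat).
Hypotheses (hC : forall x, `|h x| <= C) (m0 : (0 < m)%N).
Hypothesis gG : forall u, 0 < u <= 1 -> `|g u| <= G.
Hypothesis gM : forall u, 0 < u <= 1 -> g u * M = kappa.
Hypothesis hM : forall x, `|m%:R^-1 * \sum_(i < m) h (x + i%:R) - M| <= e.
Variable p : R * R.
Hypothesis pS : forall k, Sigma (iter k (@F R) p).

Let x k := iter k (@F R) p.
Let A : set (R * R) := [set q | q.2 < 1].
Let psi := window_primitive m.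
Let a k := g (x k).1 * psi (x k).2.
Let b k := g (x k).1 * psi ((x k).2 + 1).
Let B := G * (m%:R * C).

Let x01 k : 0 < (x k).1 <= 1.
Proof. by have [/=] := pS k; rewrite in_itv. Qed.

Let le_B u w : 0 < u <= 1 -> `|g u * psi w| <= B.
Proof. by move=> u01; rewrite normrM ler_pM ?gG// window_primitive_le. Qed.

Let B0 : 0 <= B. Proof. exact: le_trans (le_B 0 (x01 0%N)). Qed.

(** Off [A], the next point is [(u, v - 1)], so [b k.+1] equals [a k] exactly; at a visit each term
    is at most [B]. *)
Let step k : `|a k - b k.+1| <= 2 * B * (x k \in A)%:R.
Proof.
have [xA|xA] := boolP (x k \in A).
  by rewrite mulr1 mulr_natl mulr2n (le_trans (ler_normB _ _))// lerD// le_B.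
rewrite mulr0 /a /b.
have -> : x k.+1 = F (x k) by [].
have v1 : ((x k).2 < 1) = false.
  by apply/negP => v1; move/negP : xA; apply; apply/mem_set.
by rewrite /F v1/= subrK subrr normr0.
Qed.

Let telescope n : `|\sum_(k < n) (a k - b k) + b 0%N - b n| <=
  2 * B * (visits (@F R) A n p)%:R.
Proof.
elim: n => [|n IH]; first by rewrite big_ord0 add0r subrr normr0 /visits big_ord0 mulr0.
rewrite big_ord_recr/= /visits big_ord_recr/= natrD mulrDr.
have -> : \sum_(i < n) (a i - b i) + (a n - b n) + b 0%N - b n.+1 =
    (\sum_(i < n) (a i - b i) + b 0%N - b n) + (a n - b n.+1) by ring.
by rewrite (le_trans (ler_normD _ _))// lerD//; exact: step.
Qed.

Lemma orbit_sum_le n :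
  `|\sum_(k < n) g (x k).1 * h (x k).2 - n%:R * kappa| <=
  n%:R * (G * e) + 2 * (G * (m%:R * C)) * ((visits (@F R) A n p)%:R + 1).
Proof.
pose avg v := m%:R^-1 * \sum_(i < m) h (v + i%:R).
have -> : \sum_(k < n) g (x k).1 * h (x k).2 - n%:R * kappa =
    \sum_(k < n) g (x k).1 * (avg (x k).2 - M) + \sum_(k < n) (a k - b k).
  have -> : n%:R * kappa = \sum_(k < n) kappa by rewrite sumr_const card_ord mulr_natl.
  rewrite -sumrB -big_split/=; apply: eq_bigr => k _.
  rewrite -(gM (x01 k)) /a /b -[X in _ = _ + X]mulrBr /psi window_primitiveB// -/(avg _).
  ring.
rewrite (le_trans (ler_normD _ _))// lerD//.
  rewrite (le_trans (ler_norm_sum _ _ _))//.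
  rewrite (_ : n%:R * (G * e) = \sum_(k < n) G * e); last first.
    by rewrite sumr_const card_ord mulr_natl.
  by apply: ler_sum => k _; rewrite normrM ler_pM// ?gG// hM.
(* The boundary term [b n - b 0] costs [2 * B] and accounts for the [+ 1] next to the visits. *)
have -> : \sum_(k < n) (a k - b k) =
    (\sum_(k < n) (a k - b k) + b 0%N - b n) + (b n - b 0%N) by ring.
rewrite (le_trans (ler_normD _ _))// mulrDr mulr1 lerD ?telescope//.
by rewrite (le_trans (ler_normB _ _))// mulr_natl mulr2n lerD// le_B.
Qed.

End orbit.

(** * Almost every orbit stays in the domain and rarely visits the first branch *)

Section recurrence.
Context {R : realType}.
Local Notation mu := (@lebesgue_measure R).
Local Notation plane := (measurableTypeR R * measurableTypeR R)%type.

Let A : set plane := [set q | q.2 < 1].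

Let mA : measurable A.
Proof.
rewrite (_ : A = snd @^-1` `]-oo, 1[%classic); last first.
  by apply/seteqP; split => p /=; rewrite in_itv.
by rewrite -[X in measurable X]setTI; apply: measurable_snd => //; exact: measurable_itv.
Qed.

Let finA : (rho A < +oo)%E.
Proof.
rewrite (le_lt_trans (rho_le_lebesgue mA))//.
rewrite (_ : A `&` _ = `]0%R, 1%R] `*` `[0%R, 1%R[); last first.
  apply/seteqP; split => -[u v] [/= H1 H2].
    case: H2 => /= u01; rewrite in_itv/= andbT => v0.
    by split => //=; rewrite in_itv/= v0.
  move: H2; rewrite in_itv/= => /andP[v0 v1].
  by split => //; split => //=; rewrite in_itv/= v0.
rewrite product_measure1E//=; try exact: measurable_itv.
by rewrite !lebesgue_measure_itv/= lte_fin ltr01 -EFinB -EFinM ltry.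
Qed.

Lemma rho_iter_F (k : nat) (E : set plane) : measurable E ->
  rho (iter k (@F R) @^-1` E) = rho E.
Proof.
elim: k E => // k IH E mE.
rewrite -[RHS]rho_F// -(IH (@F R @^-1` E))//.
by rewrite -[X in measurable X]setTI; exact: measurable_F.
Qed.

(** The exceptional set is a countable union of null sets: the preimages of the complement of
    [Sigma] under the iterates, which catch the orbits meeting [v = 0], and the sets [frequent] for
    each [c]. *)
Lemma ae_orbit : {ae rho (R:=R), forall p,
  (forall k, Sigma (iter k (@F R) p)) /\
  forall c K : nat, exists n, forall m, (n <= m)%N ->
    (c * visits (@F R) A m p + K < m)%N}.
Proof.
have mSC : measurable (~` @Sigma R : set plane).
  by apply: measurableC; exact: measurable_Sigma.
have mFk k : measurable (iter k (@F R) @^-1` (~` @Sigma R) : set plane).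
  by rewrite -[X in measurable X]setTI; apply: measurable_iter => //; exact: measurable_F.
suff : (@rho R).-negligible ((\bigcup_k (iter k (@F R) @^-1` (~` @Sigma R))) `|`
    \bigcup_c (frequent (@F R) A c)).
  apply: negligibleS.
  move=> p /= Np; apply: contrapT => /not_orP[NS Nf]; apply: Np; split.
    by move=> k; apply: contrapT => pk; apply: NS; exists k.
  move=> c K; apply: contrapT => Nn; apply: Nf; exists c => //; exists K => n.
  apply: contrapT => Nm; apply: Nn; exists n => m nm.
  by rewrite ltnNge; apply/negP => mV; apply: Nm; exists m.
apply: negligibleU; apply: negligible_bigcup => k.
  exists (iter k (@F R) @^-1` (~` @Sigma R)); split => //.
  by apply: etrans (rho_iter_F k mSC) _; exact: rho_setCSigma.
have mfr : measurable (frequent (@F R) A k).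
  by apply: measurable_frequent => //; exact: measurable_F.
exists (frequent (@F R) A k); split => //.
apply: rho_invariant_null => //; first exact: frequent_invariant.
apply: frequent_finite => //; first exact: measurable_F.
exact: rho_F.
Qed.

End recurrence.

Lemma cvg_realC (R : realType) (x : nat -> R) (l : R) :
  (forall e, 0 < e -> exists n, forall m, (n <= m)%N -> `|x m - l| <= e) ->
  ((x n)%:C%C : R[i]^o) @[n --> \oo] --> (l%:C%C : R[i]^o).
Proof.
move=> xl; apply/cvgrPdist_le => /= e e0.
have /complex_realP[k ek] := gtr0_real e0.
rewrite ek in e0 *; rewrite ltcR in e0.
have [n nP] := xl _ e0; exists n => // m /= nm.
rewrite -rmorphB/= normc_def/= expr0n/= addr0 sqrtr_sqr lecR distrC.
exact: nP.
Qed.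

Unset Implicit Arguments.

Theorem theorem4p2 (R : realType) (alpha : R) (g h : R -> R)
    (f : R * R -> R[i]) :
  0 < alpha -> irrational alpha ->
  [bounded g u | u in (`]0, 1] : set R)] ->
  measurable_fun (`]0, 1] : set R) g ->
  continuous h -> periodic h alpha ->
  (forall u v, Sigma (u, v) -> f (u, v) = (g u * h v)%:C%C) ->
  (\int[lebesgue_measure]_(v in `[0, alpha]) h v <> 0 ->
     exists c, forall u, 0 < u <= 1 -> g u = c) ->
  exists fstar : R[i],
    {ae rho (R:=R), forall p, Sigma p ->
      ((n%:R)^-1 * \sum_(0 <= k < n) f (iter k (@F R) p) : R[i]^o)
        @[n --> \oo] --> (fstar : R[i]^o)}.
Proof.
move=> alpha0 alphaN [G0 [_ gG0]] _ ch ph fE gc.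
set M : R := alpha^-1 * \int[lebesgue_measure]_(v in `[0, alpha]) h v.
(* A single constant covers both cases of the hypothesis on [g]. *)
have [kappa gM] : exists kappa, forall u, 0 < u <= 1 -> g u * M = kappa.
  have [I0|/eqP I0] := eqVneq (\int[lebesgue_measure]_(v in `[0, alpha]) h v) 0.
    by exists 0 => u _; rewrite /M I0 !mulr0.
  by have [c gE] := gc I0; exists (c * M) => u u01; rewrite gE.
have [G G_gt0 gG] : exists2 G, 0 < G & forall u, 0 < u <= 1 -> `|g u| <= G.
  exists (`|G0| + 1) => [|u u01]; first by rewrite ltr_wpDl.
  by apply: gG0 => //=; rewrite (le_lt_trans (ler_norm G0))// ltrDl.
have [C C_ge0 hC] := continuous_periodic_bounded alpha0 ch ph.
exists kappa%:C%C; have := @ae_orbit R.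
apply: negligibleS => p; apply: contra_not => -[pS freq] _.
have -> : (fun n => n%:R^-1 * \sum_(0 <= k < n) f (iter k (@F R) p) : R[i]^o) =
   (fun n => (n%:R^-1 * \sum_(k < n) g (iter k (@F R) p).1 * h (iter k (@F R) p).2)%:C%C).
  apply/funext => n; rewrite big_mkord rmorphM/= fmorphV rmorph_nat rmorph_sum/=.
  congr (_ * _); apply: eq_bigr => k _; have := pS k.
  by case: (iter k _ p) => u v /fE ->.
apply: cvg_realC => e e0.
(* The window error is later multiplied by [G], leaving [e / 2]. *)
have eG : 0 < e / 2 / G by rewrite !divr_gt0.
have [m m0 hM] := equidistribution alpha0 ch ph alphaN eG.
have D_ge0 : 0 <= 2 * (G * (m%:R * C)) by rewrite !mulr_ge0// ltW.
set D := 2 * _ in D_ge0.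
have [c cP] : exists c : nat, D <= c%:R * (e / 2).
  exists (Num.truncn (D / (e / 2))).+1.
  by rewrite -ler_pdivrMr ?divr_gt0// ltW//; exact: truncnS_gt.
(* Taking the offset equal to [c] gives [c * (visits + 1) < k], which matches the factor
   [visits + 1] of the orbit estimate; [n.+1] ensures [0 < k]. *)
have [n nP] := freq c c; exists n.+1 => k nk.
have k0 : 0 < k%:R :> R by rewrite ltr0n (leq_trans _ nk).
have -> : kappa = k%:R^-1 * (k%:R * kappa) by rewrite mulKf// gt_eqF.
rewrite -mulrBr normrM gtr0_norm ?invr_gt0// ler_pdivrMl//.
rewrite (le_trans (orbit_sum_le hC m0 gG gM hM pS k))//.
rewrite -/D (_ : G * (e / 2 / G) = e / 2); last by rewrite mulrC divfK ?gt_eqF.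
rewrite [X in _ <= _ * X](splitr e) [leRHS]mulrDr lerD2l.
apply: le_trans (_ : c%:R * (e / 2) * _ <= _).
  by apply: ler_wpM2r cP; rewrite addr_ge0.
rewrite mulrAC ler_wpM2r//; first by rewrite divr_ge0// ltW.
rewrite natr1 -natrM ler_nat mulnS addnC.
by rewrite ltnW// nP// ltnW.
Qed.
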